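(* For every positive integer $p$ there exists a sequence of real numbers $(\delta_n)_{n\ge 1}$ with $\delta_n>0$ for all $n$ and $\lim_{n\to\infty}\delta_n=0$ such that for every $n\ge 1$ and every permutation $f\in S_n$ there exists a permutation $g\in S_n$ with $h(g^p,f)\le\delta_n$.
   Context: $S_n$ denotes the group of all permutations of $\{1,\dots,n\}$, and for $f,g\in S_n$ the normalized Hamming distance is $h(f,g)=\frac{|\{a\in\{1,\dots,n\}: f(a)\ne g(a)\}|}{n}$. *)

(* Defs.v *)
From HB Require Import structures.
From mathcomp Require Import all_boot all_order all_algebra all_fingroup.
From mathcomp Require Import all_classical all_reals all_analysis.

Set Implicit Arguments.
Unset Strict Implicit.
Unset Printing Implicit Defensive.

Import Order.TTheory GRing.Theory Num.Theory.
Import numFieldNormedType.Exports.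

Local Open Scope ring_scope.

(* Normalized Hamming distance. For n = 0 the division by 0%:R yields 0. *)
Definition hamming (R : realType) (n : nat) (f g : 'S_n) : R :=
  #|[set a : 'I_n | f a != g a]|%:R / n%:R.

(* Main.v *)
Require Import Defs.
From HB Require Import structures.
From mathcomp Require Import all_boot all_order all_algebra all_fingroup zify.

(** Short cycles: since [p] cycles of the same length [l] can be interleaved into
    one cycle of length [p l] whose [p]-th power restores them, all but fewer
    than [p] cycles of each length have an exact common [p]-th root.  Long
    cycles: cutting a cycle of length [l] into [p] arcs of length [l %/ p] and
    interleaving these gives a root that fails at no more than [2 p] points.  Calling
    a cycle long when its length exceeds [L], the failures number at most
    [2 p n / L + p L (L + 1)], which is [O (p n / L)] for [L] about [n^(1/3)]. *)

Set Implicit Arguments.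
Unset Strict Implicit.
Unset Printing Implicit Defensive.

(** * Approximate roots supported on a subset *)

(** [S] need not be stable under [f], so it may be a set of arcs of a cycle. The support condition
    on [g] lets roots on disjoint sets be multiplied. *)
Definition power_approx (T : finType) (p : nat) (f : {perm T}) (S : {set T})
    (e : nat) :=
  exists g : {perm T}, perm_on S g /\ #|[set x in S | (g ^+ p)%g x != f x]| <= e.

Lemma perm_onX (T : finType) (S : {set T}) (g : {perm T}) n :
  perm_on S g -> perm_on S (g ^+ n)%g.
Proof.
move=> gS; elim: n => [|n IHn]; first by rewrite expg0 perm_on1.
by rewrite expgS perm_onM.
Qed.

(** Disjointly supported [g] and [h] commute, so [(g * h) ^+ p] is [g ^+ p] on [A] and [h ^+ p] on
    [B], and the failures add up. *)
Lemma power_approxU (T : finType) p (f : {perm T}) (A B : {set T}) e1 e2 :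
    [disjoint A & B] -> power_approx p f A e1 -> power_approx p f B e2 ->
  power_approx p f (A :|: B) (e1 + e2).
Proof.
move=> dAB [g [gA ge]] [h [hB he]]; exists (g * h)%g; split.
  apply: perm_onM; [apply: subset_trans gA _ | apply: subset_trans hB _].
    exact: subsetUl.
  exact: subsetUr.
rewrite expgMn; last exact: perm_onC gA hB dAB.
apply: leq_trans (leq_add ge he); apply: leq_trans (leq_card_setU _ _).
apply/subset_leq_card/subsetP => x; rewrite !inE permM.
case/andP=> /orP[xA|xB] ne; apply/orP.
  left; rewrite xA; rewrite (out_perm (perm_onX p hB)) // in ne.
  by rewrite (disjointFr dAB) // perm_closed // perm_onX.
by right; rewrite xB; rewrite (out_perm (perm_onX p gA)) ?(disjointFl dAB) in ne.
Qed.

Lemma power_approx_card (T : finType) p (f : {perm T}) (S : {set T}) :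
  power_approx p f S #|S|.
Proof.
exists 1%g; split; first exact: perm_on1.
by apply/subset_leq_card/subsetP => x; rewrite inE => /andP[].
Qed.

(** * Interleaving towers into one cycle *)

Lemma iter_next_nth (T : eqType) (x0 : T) (c : seq T) i n :
    uniq c -> i < size c ->
  iter n (next c) (nth x0 c i) = nth x0 c ((i + n) %% size c).
Proof.
move=> Uc lti; elim: n => [|n IHn]; first by rewrite addn0 modn_small.
have ltm : (i + n) %% size c < size c by rewrite ltn_mod; lia.
rewrite iterS IHn next_nth mem_nth // addnS -[in RHS]addn1 -(modnDml (i + n)) addn1.
move: ltm; move: ((i + n) %% size c) => j {lti IHn}.
case: c Uc => // y c Uc ltj; rewrite index_uniq //.
(* At the last position the lookup in the tail is out of range, and its default [y] is the head of
   the cycle: this is the wrap-around. *)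
move: ltj; rewrite /= ltnS leq_eqVlt => /orP[/eqP->|ltj].
  by rewrite modnn nth_default.
by rewrite modn_small //=; apply: set_nth_default.
Qed.

(** Position [b * p + a] holds level [b] of tower [a]. *)
Definition interleave (T : Type) (p q : nat) (f : T -> T) (y : nat -> T) : seq T :=
  mkseq (fun i => iter (i %/ p) f (y (i %% p))) (p * q).

Definition tower_inj (T : Type) (p q : nat) (f : T -> T) (y : nat -> T) :=
  forall a b a' b', a < p -> b < q -> a' < p -> b' < q ->
    iter b f (y a) = iter b' f (y a') -> a = a' /\ b = b'.

Lemma mem_interleave (T : eqType) p q (f : T -> T) (y : nat -> T) x :
  reflect (exists a b, [/\ a < p, b < q & x = iter b f (y a)])
    (x \in interleave p q f y).
Proof.
apply: (iffP mapP) => [[i] | [a [b [lta ltb ->]]]].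
  rewrite mem_iota add0n => /= lti ->; have p0 : 0 < p by lia.
  by exists (i %% p), (i %/ p); rewrite ltn_mod ltn_divLR // mulnC.
have p0 : 0 < p by lia.
exists (b * p + a); first by rewrite mem_iota add0n; nia.
by rewrite divnMDl // divn_small // addn0 modnMDl modn_small.
Qed.

Lemma uniq_interleave (T : eqType) p q (f : T -> T) (y : nat -> T) :
  tower_inj p q f y -> uniq (interleave p q f y).
Proof.
move=> inj; apply/mkseq_uniqP => i j; rewrite !inE => lti ltj eF.
have p0 : 0 < p by lia.
have [] := inj (i %% p) (i %/ p) (j %% p) (j %/ p) _ _ _ _ eF.
- by rewrite ltn_mod.
- by rewrite ltn_divLR // mulnC.
- by rewrite ltn_mod.
- by rewrite ltn_divLR // mulnC.
- by move=> ea eb; rewrite (divn_eq i p) (divn_eq j p) ea eb.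
Qed.

Lemma card_interleave (T : finType) p q (f : T -> T) (y : nat -> T) :
  tower_inj p q f y -> #|[set x in interleave p q f y]| = p * q.
Proof.
by move=> inj; rewrite cardsE (card_uniqP (uniq_interleave inj)) size_mkseq.
Qed.

(* Interleaving the [p] towers [y a, f (y a), ..., f^(q-1) (y a)] into a single
   cycle makes the [p]-th power of that cycle climb every tower by one step. *)
Lemma power_approx_towers (T : finType) p q (f : {perm T}) (y : nat -> T) :
    tower_inj p q f y ->
  power_approx p f [set x in interleave p q f y]
    (count (fun a => iter q f (y a) != y a) (iota 0 p)).
Proof.
move=> inj; rewrite /interleave; set F := (X in mkseq X _); set c := mkseq F _.
have Uc : uniq c := uniq_interleave inj.
exists (perm (can_inj (prev_next Uc))); split.
  apply/subsetP => x; rewrite !inE permE.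
  by apply: contraNT => nx; rewrite next_nth (negPf nx).
(* Failures lie among the tops, at level [q.-1], of the towers that do not close up under [f]. *)
rewrite -size_filter -(size_map (fun a => iter q.-1 f (y a))).
apply: leq_trans (card_size _); apply/subset_leq_card/subsetP => x.
rewrite !inE permX => /andP[/mapP[i]].
rewrite mem_iota add0n /= => lti -> ne.
have p0 : 0 < p by lia.
have q0 : 0 < q by lia.
have szc : size c = p * q by rewrite size_mkseq.
have Fi : F i = nth (y 0) c i by rewrite nth_mkseq.
have lta : i %% p < p by rewrite ltn_mod.
have ltb : i %/ p < q by rewrite ltn_divLR // mulnC.
rewrite (eq_iter (permE _)) Fi iter_next_nth ?szc // -Fi in ne.
rewrite nth_mkseq in ne; last by rewrite ltn_mod; lia.
have [ltS|geS] := ltnP (i %/ p).+1 q.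
  case/negP: ne; rewrite modn_small; last first.
    rewrite (divn_eq i p) -addnA (addnC (_ %% _)) addnA -mulSnr mulnC.
    by rewrite -ltn_divLR // in ltS *; nia.
  by rewrite /F modnDr divnDr // divnn p0 addn1.
have eb : i %/ p = q.-1 by lia.
have ei : i = q.-1 * p + i %% p by rewrite {1}(divn_eq i p) eb.
apply/mapP; exists (i %% p); last by rewrite /F eb.
rewrite mem_filter mem_iota leq0n add0n lta !andbT.
move: ne; apply: contra_neq => qa; rewrite /F eb.
(* From the top level, [p] places forward wraps around to the base of the same tower. *)
have -> : (i + p) %% (p * q) = i %% p.
  have -> : i + p = p * q + i %% p by rewrite {1}ei; case: (q) q0 => //= *; nia.
  by rewrite modnDl modn_small //; nia.
by rewrite divn_small // modn_small // -iterS prednK //= qa.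
Qed.

(** * Roots on one cycle and on [p] cycles of equal length *)

Lemma power_approx_leq (T : finType) p (f : {perm T}) (S : {set T}) e1 e2 :
  e1 <= e2 -> power_approx p f S e1 -> power_approx p f S e2.
Proof. by move=> le12 [g [gS le1]]; exists g; split=> //; apply: leq_trans le12. Qed.

Lemma porbit_iterP (T : finType) (f : {perm T}) x z :
  reflect (exists2 i, i < #|porbit f x| & z = iter i f x) (z \in porbit f x).
Proof. by rewrite porbit_traject; apply: trajectP. Qed.

Lemma iter_porbit_inj (T : finType) (f : {perm T}) x i j :
    i < #|porbit f x| -> j < #|porbit f x| ->
  iter i f x = iter j f x -> i = j.
Proof.
move=> lti ltj; rewrite -(nth_traject f lti) -(nth_traject f ltj) => /eqP.
by rewrite nth_uniq ?size_traject ?uniq_traject_porbit // => /eqP.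
Qed.

(** The towers are [p] consecutive arcs of length [q = l %/ p], each failing at most at its top. The
    other [p] covers the [l %% p] leftover points, fixed by the root. If [l < p], the arcs are empty
    and the whole cycle is leftover. *)
Lemma power_approx_porbit (T : finType) p (f : {perm T}) x :
  0 < p -> power_approx p f (porbit f x) (p + p).
Proof.
move=> p0; set O := porbit f x; set l := #|O|; set q := l %/ p.
have lepq : p * q <= l by rewrite mulnC leq_divM.
pose y a := iter (a * q) f x.
have inj : tower_inj p q f y.
  move=> a b a' b' lta ltb lta' ltb'; rewrite -!iterD => /iter_porbit_inj.
  move=> e; have {}e : b + a * q = b' + a' * q by apply: e; rewrite -/O -/l; nia.
  have q0 : 0 < q by lia.
  have ea : a = a'.
    have := congr1 (fun i => i %/ q) e.
    by rewrite ![_ + _ * q]addnC !divnMDl // !divn_small // !addn0.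
  by move: e; rewrite ea => /addIn.
set B := [set z in interleave p q f y].
have BO : B \subset O.
  apply/subsetP => z; rewrite inE => /mem_interleave[a [b [_ _ ->]]].
  by rewrite -iterD -permX mem_porbit.
rewrite -(setID O B) (setIidPr BO); apply: power_approxU.
- by rewrite disjoint_sym -setI_eq0 setIDAC setDIl setDv setI0.
- apply: power_approx_leq (power_approx_towers inj).
  by apply: leq_trans (count_size _ _) _; rewrite size_iota.
- apply: power_approx_leq (power_approx_card _ _ _).
  rewrite cardsD (setIidPr BO) card_interleave // -/l /q {1}(divn_eq l p).
  by rewrite mulnC addKn ltnW // ltn_mod.
Qed.

(** Each tower is now a whole cycle, so it closes up after [q] steps and its top does not fail. *)
Lemma power_approx_porbits (T : finType) p q (f : {perm T}) (y : nat -> T) :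
    (forall a, a < p -> #|porbit f (y a)| = q) ->
    (forall a a', a < p -> a' < p ->
      porbit f (y a) = porbit f (y a') -> a = a') ->
  #|\bigcup_(a < p) porbit f (y a)| = p * q /\
  power_approx p f (\bigcup_(a < p) porbit f (y a)) 0.
Proof.
move=> cardy injy.
have inj : tower_inj p q f y.
  move=> a b a' b' lta ltb lta' ltb' e.
  have ea : a = a'.
    by apply: injy => //; rewrite -(porbit_perm f b) permX e -permX porbit_perm.
  by split=> //; apply: (@iter_porbit_inj _ f (y a)); rewrite ?cardy // {2}ea.
have <- : [set x in interleave p q f y] = \bigcup_(a < p) porbit f (y a).
  apply/setP => x; rewrite inE; apply/mem_interleave/bigcupP.
    by case=> a [b [lta _ ->]]; exists (Ordinal lta); rewrite // -permX mem_porbit.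
  case=> a _ /porbit_iterP[b]; rewrite cardy // => ltb ->.
  by exists a, b.
split; first exact: card_interleave.
apply: power_approx_leq (power_approx_towers inj).
rewrite leqNgt -has_count; apply/hasPn => a.
rewrite mem_iota add0n /= => lta; rewrite negbK.
by rewrite -{1}(cardy a lta) iter_porbit.
Qed.

(** * Peeling off cycles *)

(** Strong induction on the size of [S]: remove a cycle longer than [L], or [p] cycles of equal
    length, until neither is available. The factor [L] on the left avoids division. *)
Lemma power_approx_stable (T : finType) p L (f : {perm T}) (S : {set T}) :
    0 < p -> {in S, forall x, porbit f x \subset S} ->
  exists2 e, power_approx p f S e & L * e <= (p + p) * #|S| + L * (p * L * L.+1).
Proof.
move=> p0; have [n] := ubnP #|S|; elim: n S => // n IHn S ltSn stS.
(* The failures on a removed [B] are charged to its own points; the additive term is left for the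
   final remainder. *)
have step (B : {set T}) e : B \subset S -> 0 < #|B| -> {in B, forall x, porbit f x \subset B} ->
    power_approx p f B e -> L * e <= (p + p) * #|B| ->
  exists2 e, power_approx p f S e & L * e <= (p + p) * #|S| + L * (p * L * L.+1).
  move=> BS B0 stB aB leB.
  have cS : #|S| = #|B| + #|S :\: B| by rewrite -(cardsID B S) (setIidPr BS).
  have [||e' aD leD] := IHn (S :\: B); first by lia.
    move=> x; rewrite inE => /andP[xB xS]; apply/subsetP => z zx.
    rewrite inE (subsetP (stS x xS)) // andbT; apply: contra xB => zB.
    by rewrite (subsetP (stB z zB)) // porbit_sym.
  exists (e + e'); last by rewrite cS; nia.
  rewrite -(setID S B) (setIidPr BS); apply: power_approxU aB aD.
  by rewrite disjoint_sym -setI_eq0 setIDAC setDIl setDv setI0.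
have [x /andP[xS ltx]|short] := pickP [pred x in S | L < #|porbit f x|].
  apply: (step (porbit f x) (p + p)) (power_approx_porbit _ _ p0) _.
  - exact: stS.
  - by rewrite lt0n card_porbit_neq0.
  - by move=> z; rewrite -eq_porbit_mem => /eqP->.
  - by nia.
pose A (l : 'I_L.+1) := [set x in S | #|porbit f x| == l].
(* If every length from [0] to [L] accounts for at most [p * L] points, then [S] has at most
   [p * L * L.+1] points and the identity suffices. *)
have [l ltA|few] := pickP (fun l => p * L < #|A l|); last first.
  exists #|S|; first exact: power_approx_card.
  apply: leq_trans (leq_addl _ _); rewrite leq_mul2l; apply/orP; right.
  rewrite -sum1_card (partition_big (fun x => inord #|porbit f x| : 'I_L.+1) xpredT) //=.
  apply: leq_trans (_ : \sum_(l < L.+1) p * L <= _); last first.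
    by rewrite sum_nat_const card_ord mulnC.
  apply: leq_sum => l _; rewrite sum1dep_card.
  have /= /negbT := few l; rewrite -leqNgt; apply: leq_trans.
  apply/subset_leq_card/subsetP => x; rewrite !inE.
  case xS: (x \in S) => //=; rewrite -val_eqE /= inordK // ltnS leqNgt.
  by have /= := short x; rewrite xS /= => ->.
(* [A l] is a union of cycles of length [l <= L], so more than [p * L] points force at least [p]
   cycles; [s] takes one point from each of [p] of them. *)
have [s []] : exists s : seq T, [/\ size s = p, uniq (map (porbit f) s) & {subset s <= A l}].
  have coverA : #|A l| <= #|porbit f @: A l| * l.
    have cA : cover (porbit f @: A l) = A l.
      apply/setP => z; apply/bigcupP/idP => [[_ /imsetP[x + ->]]|zA]; last first.
        by exists (porbit f z); rewrite ?imset_f ?porbit_id.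
      rewrite !inE => /andP[xS /eqP cx] zx.
      by rewrite (subsetP (stS x xS)) // -cx; move: zx; rewrite -eq_porbit_mem => /eqP->/=.
    rewrite -sum_nat_const -{1}cA.
    apply: leq_trans (leq_card_cover _).1 _; apply: leq_sum => _ /imsetP[x + ->].
    by rewrite inE => /andP[_ /eqP->].
  have lep : p <= #|porbit f @: A l| by have := ltn_ord l; nia.
  have gen (P : seq {set T}) : {subset P <= porbit f @: A l} ->
      exists2 s, map (porbit f) s = P & {subset s <= A l}.
    elim: P => [|O P IHP] sub; first by exists nil.
    have [|s es sA] := IHP; first by move=> z zP; apply: sub; rewrite inE zP orbT.
    have /imsetP[x xA eO] := sub O (mem_head _ _).
    exists (x :: s) => [|z]; first by rewrite /= es eO.
    by rewrite inE => /predU1P[->|/sA].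
  have [|s es sA] := gen (take p (enum (porbit f @: A l))).
    by move=> z /mem_take; rewrite mem_enum.
  exists s; split=> //; last by rewrite es take_uniq ?enum_uniq.
  by rewrite -(size_map (porbit f)) es size_take_min -cardE; apply/minn_idPl.
move=> szs Us sA; have [x0 _] : exists x0 : T, x0 \in s.
  by case: s szs {Us sA} => [/= e|x0 s _]; [rewrite -e in p0 | exists x0; rewrite mem_head].
have yA a : a < p -> nth x0 s a \in A l by move=> lta; rewrite sA ?mem_nth ?szs.
have [||cB aB] := @power_approx_porbits T p l f (nth x0 s).
- by move=> a /yA; rewrite inE => /andP[_ /eqP].
- move=> a a' lta lta' e; apply/eqP.
  by rewrite -(nth_uniq set0 _ _ Us) ?size_map ?szs // !(nth_map x0) ?szs // e.
apply: step aB _; last by rewrite muln0.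
- apply/bigcupsP => a _; apply: stS.
  by have := yA a (ltn_ord a); rewrite inE => /andP[].
- rewrite cB muln_gt0 p0 /=; have := yA 0 p0; rewrite inE => /andP[_ /eqP<-].
  by rewrite lt0n card_porbit_neq0.
- move=> x /bigcupP[a _ xa]; apply/subsetP => z zx; apply/bigcupP; exists a => //.
  by move: xa zx; rewrite -!eq_porbit_mem => /eqP->.
Qed.

(** The bound on [L ^ 3] makes the short-cycle term at most [2 * p * #|T|], the same as the
    long-cycle term. *)
Lemma exists_approx_root (T : finType) p L (f : {perm T}) :
    0 < p -> L ^ 3 <= #|T| ->
  exists g : {perm T}, L * #|[set x | (g ^+ p)%g x != f x]| <= 4 * p * #|T|.
Proof.
move=> p0 leL; have [|e [g [_ ge]] le] := @power_approx_stable T p L f setT p0.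
  by move=> x _; apply: subsetT.
exists g; apply: (@leq_trans (L * e)).
  rewrite leq_mul2l; apply/orP; right; apply: leq_trans ge.
  by apply/subset_leq_card/subsetP => x; rewrite !inE.
apply: leq_trans le _; rewrite cardsT.
(* [L.+1 <= 2 * L] for positive [L], and both sides vanish at [L = 0]. *)
have : L * (p * L * L.+1) <= 2 * p * L ^ 3 by nia.
nia.
Qed.

(** * Choice of the cutoff and the limit *)

Lemma cube_root_subproof n : exists L, L ^ 3 <= n.
Proof. by exists 0. Qed.

Lemma cube_root_bound n L : L ^ 3 <= n -> L <= n.
Proof. by apply: leq_trans; case: L => // L; rewrite expnS leq_pmulr ?expn_gt0. Qed.

(** The cube root rounded down, the largest cutoff that [exists_approx_root] admits on [n]
    points. *)
Definition cube_root n := ex_maxn (cube_root_subproof n) (@cube_root_bound n).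

Lemma cube_rootX n : cube_root n ^ 3 <= n.
Proof. by rewrite /cube_root; case: ex_maxnP. Qed.

Lemma leq_cube_root L n : L ^ 3 <= n -> L <= cube_root n.
Proof. by rewrite /cube_root; case: ex_maxnP => m _; apply. Qed.

(* Imported only here because it shadows finset names such as [subset_trans]. *)
From mathcomp Require Import all_classical all_reals all_analysis.

Import Order.TTheory GRing.Theory Num.Theory.
Import numFieldNormedType.Exports.

Local Open Scope classical_set_scope.
Local Open Scope ring_scope.

Theorem theorem1 (R : realType) (p : nat) (hp : (0 < p)%N) :
  exists delta : nat -> R,
    [/\ forall n : nat, (1 <= n)%N -> 0 < delta n,
        delta n @[n --> \oo] --> (0 : R)
      & forall n : nat, (1 <= n)%N -> forall f : 'S_n, exists g : 'S_n,
          hamming R (g ^+ p)%g f <= delta n].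
Proof.
have root_gt0 n : (0 < n)%N -> (0 < cube_root n)%N.
  by move=> n0; apply: leq_cube_root.
(* This is the bound [4 * p * n] divided by [L * n], with [L = cube_root n]. *)
exists (fun n => (4 * p)%:R / (cube_root n)%:R); split.
- by move=> n n0; rewrite divr_gt0 // ltr0n ?muln_gt0 ?hp ?root_gt0.
- apply/cvgrPdist_le => e e0.
  (* [M] exceeds [4 * p / e], and [n >= M ^ 3] gives [cube_root n >= M]. *)
  set M := (Num.trunc ((4 * p)%:R / e)).+1.
  exists (M ^ 3)%N => // n /= leMn.
  have leM : (M <= cube_root n)%N by apply: leq_cube_root.
  have r0 : (0 : R) < (cube_root n)%:R by rewrite ltr0n (leq_trans _ leM).
  rewrite sub0r normrN ger0_norm ?divr_ge0 // ler_pdivrMr // mulrC -ler_pdivrMr //.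
  by rewrite (le_trans (ltW (truncnS_gt _))) // ler_nat.
- move=> n n0 f; have [|g bad] := @exists_approx_root 'I_n p (cube_root n) f hp.
    by rewrite card_ord cube_rootX.
  exists g; rewrite /hamming ler_pdivrMr ?ltr0n // mulrAC ler_pdivlMr ?ltr0n ?root_gt0 //.
  by rewrite -!natrM ler_nat mulnC; rewrite card_ord in bad.
Qed.
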